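(* Let $\Sigma$ be any rotationally symmetric compact hypersurface in the Heisenberg group $\mathbb{H}_1$ with the p-normal vectors defined almost everywhere on $\Sigma$. Suppose $\Sigma=\Sigma^+\cup\Sigma^-$ can be represented by $$\Sigma^{\pm}:(r,\theta)\mapsto (r\cos\theta,\,r\sin\theta,\,h^\pm(r)),$$ for some functions $h^+\ge 0$, $h^-\le 0$, and $0\le\theta\le 2\pi$, $0\le r\le R$ for some positive number $R$. Suppose $h^+$ and $h^-$ satisfy any of the following conditions: (1) $\frac{dh^+}{dr}$ or $\frac{dh^-}{dr}$ is continuous on the interval $[0,R]$; (2) $\left|\frac{dh^+}{dr}\right|$ or $\left|\frac{dh^-}{dr}\right|$ is bounded by $\frac{r}{\sqrt{R^2-r^2}}$ on the interval $[0,R)$. Then for any vector $u(0)=(\sin\alpha\cos\beta,\sin\alpha\sin\beta,\cos\alpha)$ in $\mathbb{S}^2$, $0\le\alpha\le\pi$, $0\le\beta\le2\pi$, regarded as a tangent vector at the origin, the projected p-area of $\Sigma$ onto the subspace $u(0)^\perp$ perpendicular to $u(0)$ is given by $$\mathcal{A}(\Sigma|u(0)^\perp)=\int_{q\in\Sigma}|L_{q*}u(0)\cdot N(q)|\,d\Sigma_q=|\sin\alpha|\,C,$$ where $N(q)$ is the unit p-normal vector at $q\in\Sigma$ and $C$ is a constant independent of the choice of the vector $u(0)$. In particular, when $\alpha=\frac{\pi}{2}$, the identity becomes $$\mathcal{A}(\Sigma|\tilde N(p)^\perp)=\int_{q\in\Sigma}|L_{qp^{-1}*}\tilde N(p)\cdot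 N(q)|\,d\Sigma_q=C,$$ where $\tilde N(p)$ is any unit p-normal vector at a point $p$ of the Pansu sphere $\mathcal{P}^1_\lambda$, and $C$ is independent of the choice of $\tilde N(p)$.
   Context: The Heisenberg group $\mathbb{H}_1$ is $\mathbb{R}^3$ with coordinates $(x,y,z)$ and group law given by left translation $L_{(x,y,z)}(x',y',z')=(x+x',y+y',z+z'+yx'-xy')$; $L_{qp^{-1}}=L_q\circ L_{p^{-1}}$, and a subscript $*$ denotes the pushforward (differential). The left-invariant fields $\mathring e_1=\partial_x+y\partial_z$, $\mathring e_2=\partial_y-x\partial_z$ span the contact planes $\xi=\ker(dz+x\,dy-y\,dx)$. The inner product $\cdot$ is the Levi metric on $\xi$, for which $\{\mathring e_1,\mathring e_2\}$ is orthonormal, extended to all tangent vectors by taking $T=\partial_z$ to be a unit vector orthogonal to $\xi$. A point $p$ of a surface $\Sigma$ is singular if $T_p\Sigma=\xi_p$, and nonsingular otherwise; at a nonsingular point the p-normal $N(p)\in\xi_p$ is the unit vector (unique up to sign) orthogonal to $T_p\Sigma\cap\xi_p$. For a graph $z=f(x,y)$, with $D=[(f_x-y)^2+(f_y+x)^2]^{1/2}$, the p-area element is $d\Sigma=D\,dx\,dy$ and $N=\frac{-1}{D}[(f_x-y)\mathring e_1+(f_y+x)\mathring e_2]$ up to sign; integrals over $\Sigma=\Sigma^+\cup\Sigma^-$ are sums of the integrals over the two graphs. ''Almost everywhere'' means except possibly on a set of zero p-area. For $\lambda>0$, the Pansu sphere $\mathcal{P}^1_\lambda$ is the union of the graphs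 $z=\pm f$ over $\{r\le1/\lambda\}$, with $r=\sqrt{x^2+y^2}$ and $f=\frac{1}{2\lambda^2}\big(\lambda r\sqrt{1-\lambda^2r^2}+\cos^{-1}(\lambda r)\big)$; its only singular points are the poles $(0,0,\pm\frac{\pi}{4\lambda^2})$, and $\tilde N(p)$ is defined at all other points. *)

(* Defs.v *)
From HB Require Import structures.
From mathcomp Require Export all_boot all_order all_algebra.
From mathcomp Require Export all_classical all_reals all_analysis.

Set Implicit Arguments.
Unset Strict Implicit.
Unset Printing Implicit Defensive.

Import Order.TTheory GRing.Theory Num.Theory.
Import numFieldNormedType.Exports.

Local Open Scope classical_set_scope.
Local Open Scope ring_scope.

Section Heisenberg.
Context {R : realType}.

(* Both the points of H_1 and the tangent vectors (in the coordinate frame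
   d/dx, d/dy, d/dz) are triples ((x, y), z). *)
Implicit Types (p q v w : R * R * R) (S T : set (R * R * R)).

Definition hmul p q : R * R * R :=
  (p.1.1 + q.1.1, p.1.2 + q.1.2,
   p.2 + q.2 + p.1.2 * q.1.1 - p.1.1 * q.1.2).

Definition hinv p : R * R * R := (- p.1.1, - p.1.2, - p.2).

(* The differential at p of the left translation by g, applied to v. *)
Definition push (g p v : R * R * R) : R * R * R :=
  'd (hmul g : R * R * R -> R * R * R) p v.

(* The form dz + x dy - y dx. *)
Definition contact_form p v : R := v.2 + p.1.1 * v.1.2 - p.1.2 * v.1.1.

Definition contact_plane p : set (R * R * R) := [set v | contact_form p v = 0].

(* v = v.1.1 e1 + v.1.2 e2 + (contact_form p v) T, where e1 = (1, 0, y),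
   e2 = (0, 1, -x) and T = (0, 0, 1): this is the metric for which
   (e1, e2, T) is orthonormal. *)
Definition levi p v w : R :=
  v.1.1 * w.1.1 + v.1.2 * w.1.2 + contact_form p v * contact_form p w.

(* Velocities at p of the curves lying in S. *)
Definition tangent_space S p : set (R * R * R) :=
  [set v | exists c : R -> R * R * R,
     [/\ c 0 = p, \forall t \near (0 : R), S (c t)
       & is_derive (0 : R) (1 : R) c v]].

Definition is_plane T : Prop :=
  exists a b : R * R * R,
    (forall s t : R, s *: a + t *: b = 0 -> s = 0 /\ t = 0) /\
    T = [set v | exists s t : R, v = s *: a + t *: b].

Definition nonsingular S p : Prop :=
  is_plane (tangent_space S p) /\ tangent_space S p <> contact_plane p.

Definition is_pnormal S p n : Prop :=
  [/\ nonsingular S p, contact_plane p n, levi p n n = 1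
    & forall v, (tangent_space S p `&` contact_plane p) v -> levi p n v = 0].

(* A choice of one of the two p-normals at each point where they exist. *)
Definition pnormal_field S (N : R * R * R -> R * R * R) : Prop :=
  forall q, S q -> nonsingular S q -> is_pnormal S q (N q).

Definition rotate (t : R) p : R * R * R :=
  (cos t * p.1.1 - sin t * p.1.2, sin t * p.1.1 + cos t * p.1.2, p.2).

Definition rotationally_symmetric S : Prop :=
  forall t p, S p -> S (rotate t p).

Definition radius (w : R * R) : R := Num.sqrt (w.1 ^+ 2 + w.2 ^+ 2).

Definition disc (rho : R) : set (R * R) := [set w | radius w <= rho].

Definition revolve (h : R -> R) (w : R * R) : R := h (radius w).

Definition sheet (rho : R) (h : R -> R) : set (R * R * R) :=
  [set q | exists r theta : R,
     [/\ 0 <= r <= rho, 0 <= theta <= 2 * pi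
       & q = (r * cos theta, r * sin theta, h r)]].

Definition parea_density (f : R * R -> R) (w : R * R) : R :=
  Num.sqrt (('D_((1, 0) : R * R) f w - w.2) ^+ 2 +
            ('D_((0, 1) : R * R) f w + w.1) ^+ 2).

Local Notation leb2 := (@lebesgue_measure R \x @lebesgue_measure R)%E.

(* Integral of F against the p-area of the graph of revolve h over the disc
   of radius rho. *)
Definition sheet_integral (rho : R) (h : R -> R) (F : R * R * R -> R) : \bar R :=
  (\int[leb2]_(w in disc rho)
     (F (w, revolve h w) * parea_density (revolve h) w)%:E)%E.

(* A partial derivative that does not exist takes the default value 0 in
   parea_density, which is then nonzero off the coordinate axes: a set of
   points lacking a partial derivative is null only if it is Lebesgue null. *)
Definition parea_null (rho : R) (h : R -> R) S : Prop :=
  exists B : set (R * R),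
    [/\ measurable B, [set w | disc rho w /\ S (w, revolve h w)] `<=` B
      & (\int[leb2]_(w in B) (parea_density (revolve h) w)%:E = 0)%E].

(* The projected p-area, onto the orthogonal complement of a vector with
   left-invariant extension V, of the surface made of the sheets of hp and hm,
   with p-normal field N. *)
Definition projected_parea (rho : R) (hp hm : R -> R)
    (N V : R * R * R -> R * R * R) : \bar R :=
  (sheet_integral rho hp (fun q => `|levi q (V q) (N q)|%R) +
   sheet_integral rho hm (fun q => `|levi q (V q) (N q)|%R))%E.

(* l is the derivative at r of the restriction of h to A; it is one-sided at
   the endpoints of an interval A. *)
Definition deriv_within (A : set R) (h : R -> R) (r l : R) : Prop :=
  (h t - h r) / (t - r) @[t --> within A r^'] --> l.

Definition C1_profile (rho : R) (h : R -> R) : Prop :=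
  exists h' : R -> R,
    (forall r : R, 0 <= r <= rho -> deriv_within `[0, rho] h r (h' r)) /\
    {within `[0, rho], continuous h'}.

Definition bounded_profile (rho : R) (h : R -> R) : Prop :=
  exists h' : R -> R,
    (forall r : R, 0 <= r < rho -> deriv_within `[0, rho] h r (h' r)) /\
    (forall r : R, 0 <= r < rho -> `|h' r| <= r / Num.sqrt (rho ^+ 2 - r ^+ 2)).

Definition pansu_profile (lambda r : R) : R :=
  (2 * lambda ^+ 2)^-1 *
  (lambda * r * Num.sqrt (1 - lambda ^+ 2 * r ^+ 2) + acos (lambda * r)).

Definition pansu_sphere (lambda : R) : set (R * R * R) :=
  [set p | radius p.1 <= lambda^-1 /\
     (p.2 = pansu_profile lambda (radius p.1) \/
      p.2 = - pansu_profile lambda (radius p.1))].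

End Heisenberg.

(* Main.v *)
Require Import Defs.
Import Order.TTheory GRing.Theory Num.Theory.
Import numFieldNormedType.Exports.
From mathcomp Require Import measurable_realfun numfun.
From mathcomp Require Import ring lra.

(* On the graph of a radial function f, put a = f_x - y and b = f_y + x, so
   that the p-area density is D = sqrt (a^2 + b^2).  Left-invariant fields have
   constant components in the frame (e1, e2, T), and the p-normal n is
   horizontal, so only the horizontal part (u, v) of the vector matters.  The
   vector -b e1 + a e2 is horizontal and tangent to the graph, whence
   n = +-(a, b) / D and |u n1 + v n2| D = |u a + v b|.  For a unit vector
   (u, v) the right-hand side is the value at the rotated point
   (u x + v y, u y - v x) of |f' x / r - y|, so its integral over the disc does
   not depend on (u, v).  It is finite because the conditions on the profile
   give |f'| <= K / sqrt (rho^2 - r^2), which is integrable on the disc. *)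

Set Implicit Arguments.
Unset Strict Implicit.
Unset Printing Implicit Defensive.

Local Open Scope classical_set_scope.
Local Open Scope ring_scope.

(** * Comparison of integrals of nonnegative functions that need not be measurable *)

Section integrals.
Context d (T : measurableType d) (R : realType) (mu : {measure set T -> \bar R}).
Import HBNNSimple.
Local Open Scope ereal_scope.

(* The p-normal field is an arbitrary choice of signs, so [ge0_ae_eq_integral],
   which asks for measurable integrands, does not apply to the projected area. *)
Lemma ge0_le_integral_off_null (Z : set T) (f g : T -> \bar R) :
  measurable Z -> mu Z = 0 -> (forall x, 0 <= f x) -> (forall x, 0 <= g x) ->
  (forall x, ~ Z x -> f x <= g x) ->
  \int[mu]_x f x <= \int[mu]_x g x.
Proof.
move=> mZ Z0 f0 g0 fg.
rewrite [X in X <= _]ge0_integralTE// [leRHS]ge0_integralTE//.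
apply: ge_ereal_sup => _ [h /= hf <-].
have mZC : measurable (~` Z) by exact: measurableC.
(* A simple function below [f] is cut off to 0 on [Z]: it then lies below [g] everywhere, and its
   integral is unchanged because [Z] is null. *)
pose k := mul_nnsfun h (indic_nnsfun R mZC).
apply: ereal_sup_ubound; exists k => /=.
  move=> x; rewrite /mul_nnsfun/= mindicE.
  have [Zx|Zx] := pselect (Z x).
    by rewrite memNset ?mulr0// => /(_ Zx).
  by rewrite mem_set// mulr1 (le_trans (hf x))// fg.
rewrite -!integralT_nnsfun; apply: ge0_ae_eq_integral => //.
- exact/measurable_EFinP.
- exact/measurable_EFinP.
- by move=> x _; rewrite lee_fin.
- by move=> x _; rewrite lee_fin.
exists Z; split => // x /=; apply: contra_notP => Zx _.
by rewrite mindicE mem_set// mulr1.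
Qed.

(** The comparison is made both ways on the extensions by zero, so the two domains may differ as
    well. *)
Lemma ge0_eq_integral_off_null (Z D E : set T) (f g : T -> \bar R) :
  measurable Z -> mu Z = 0 ->
  (forall x, D x -> 0 <= f x) -> (forall x, E x -> 0 <= g x) ->
  (forall x, ~ Z x -> (f \_ D) x = (g \_ E) x) ->
  \int[mu]_(x in D) f x = \int[mu]_(x in E) g x.
Proof.
move=> mZ Z0 f0 g0 fg; rewrite integral_mkcond [RHS]integral_mkcond.
apply/eqP; rewrite eq_le; apply/andP; split;
  apply: (ge0_le_integral_off_null mZ Z0);
  by [exact: erestrict_ge0|move=> x /fg ->].
Qed.

End integrals.

(** * Invariance of planar Lebesgue measure under rotations; circles are null *)

Section plane.
Context {R : realType}.
Local Notation mu := (@lebesgue_measure R).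
Local Notation leb2 := (@lebesgue_measure R \x @lebesgue_measure R)%E.
Local Open Scope ereal_scope.

Local Notation mR := (measurableTypeR R).

(** The image of Lebesgue measure under a translation has the same values on half-open intervals,
    which determine the measure. *)
Lemma lebesgue_measure_shift (a : R) (A : set mR) : measurable A ->
  mu ((fun x : R => x + a)%R @^-1` A) = mu A.
Proof.
move=> mA.
pose phi (x : mR) : mR := (x + a)%R.
have mphi : measurable_fun setT phi by exact: measurable_funD.
pose nu : {measure set mR -> \bar R} := pushforward mu phi.
apply/esym; change (mu A = nu mphi A).
apply: lebesgue_measure_unique => // _ [[b c]] _ <-.
change (mu `]b, c]%classic = mu (phi @^-1` `]b, c]%classic)).
have -> : phi @^-1` `]b, c]%classic = `](b - a)%R, (c - a)%R]%classic.
  by apply/seteqP; split => x /=; rewrite /phi !in_itv/= ltrBlDr lerBrDr.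
rewrite !lebesgue_measure_itv/= !lte_fin ltrD2r.
by case: ifPn => // _; rewrite -!EFinD; congr EFin; rewrite opprB addrA subrK.
Qed.

Lemma ge0_integral_shift (a : R) (f : mR -> \bar R) :
  measurable_fun [set: mR] f -> (forall x, 0 <= f x) ->
  \int[mu]_x f (x + a)%R = \int[mu]_x f x.
Proof.
move=> mf f0.
pose phi (x : mR) : mR := (x + a)%R.
have mphi : measurable_fun setT phi by exact: measurable_funD.
have := ge0_integral_pushforward mphi mu measurableT mf (fun x _ => f0 x).
rewrite preimage_setT => <-.
pose nu : {measure set mR -> \bar R} := pushforward mu phi.
apply: (@eq_measure_integral _ _ _ _ mu (nu mphi)) => A mA _.
exact: lebesgue_measure_shift.
Qed.

(** Tonelli with the sheared coordinate integrated first: once the other coordinate is fixed, the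
    shear is a translation. *)
Lemma ge0_integral_shear1 (p : R) (f : mR * mR -> \bar R) :
  measurable_fun [set: mR * mR] f -> (forall x, 0 <= f x) ->
  \int[leb2]_w f (w.1 + p * w.2, w.2)%R = \int[leb2]_w f w.
Proof.
move=> mf f0.
have ms : measurable_fun setT
    (fun w : mR * mR =>
      (w.1 + p * w.2, w.2)%R : mR * mR).
  apply: measurable_fun_pair => //.
  by apply: measurable_funD => //; apply: measurable_funM.
apply: (etrans (fubini_tonelli2 (m1 := mu) (m2 := mu) _
  (measurableT_comp mf ms) (fun=> f0 _))).
apply/esym/(etrans (fubini_tonelli2 (m1 := mu) (m2 := mu) _ mf f0)).
apply: eq_integral => y _; rewrite /fubini_G/=.
rewrite -[LHS](ge0_integral_shift (p * y)%R)//.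
exact: measurable_fun_pair1.
Qed.

Lemma ge0_integral_shear2 (p : R) (f : mR * mR -> \bar R) :
  measurable_fun [set: mR * mR] f -> (forall x, 0 <= f x) ->
  \int[leb2]_w f (w.1, w.2 + p * w.1)%R = \int[leb2]_w f w.
Proof.
move=> mf f0.
have ms : measurable_fun setT
    (fun w : mR * mR =>
      (w.1, w.2 + p * w.1)%R : mR * mR).
  apply: measurable_fun_pair => //.
  by apply: measurable_funD => //; apply: measurable_funM.
apply: (etrans (fubini_tonelli1 (m1 := mu) (m2 := mu) _
  (measurableT_comp mf ms) (fun=> f0 _))).
apply/esym/(etrans (fubini_tonelli1 (m1 := mu) (m2 := mu) _ mf f0)).
apply: eq_integral => x _; rewrite /fubini_F/=.
rewrite -[LHS](ge0_integral_shift (p * x)%R)//.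
exact: measurable_fun_pair2.
Qed.

(* A rotation by an angle other than pi is a product of three shears. *)
Lemma ge0_integral_rotation (u v : R) (f : mR * mR -> \bar R) :
  measurable_fun [set: mR * mR] f -> (forall x, 0 <= f x) ->
  (u ^+ 2 + v ^+ 2 = 1)%R -> (u != -1)%R ->
  \int[leb2]_w f (u * w.1 + v * w.2, u * w.2 - v * w.1)%R = \int[leb2]_w f w.
Proof.
move=> mf f0 uv1 uN1.
have u1 : (1 + u != 0)%R by rewrite addrC -[X in (_ + X)%R]opprK subr_eq0.
(* With [u] and [v] the cosine and sine of an angle, [p] is the tangent of its half. The shears have
   parameters [p], [- v], [p], and the next two identities are what their product needs to be the
   rotation. *)
pose p := (v / (1 + u))%R.
have pu : (p * (1 + u) = v)%R by rewrite divfK.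
have vp : (v * p = 1 - u)%R.
  rewrite /p mulrA -expr2; apply: (mulIf u1); rewrite divfK//.
  by rewrite -(addrK (u ^+ 2)%R (v ^+ 2)%R) [(v ^+ 2 + _)%R]addrC uv1; ring.
have shear1 : measurable_fun setT
    (fun w : mR * mR =>
      (w.1 + p * w.2, w.2)%R : mR * mR).
  apply: measurable_fun_pair => //.
  by apply: measurable_funD => //; apply: measurable_funM.
have shear2 : measurable_fun setT
    (fun w : mR * mR =>
      (w.1, w.2 + - v * w.1)%R : mR * mR).
  apply: measurable_fun_pair => //.
  by apply: measurable_funD => //; apply: measurable_funM.
have mf1 := measurableT_comp mf shear1.
have mf2 := measurableT_comp mf1 shear2.
apply/esym/(etrans (esym (ge0_integral_shear1 p mf f0))).
apply: (etrans (esym (ge0_integral_shear2 (- v) mf1 (fun=> f0 _)))).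
apply: (etrans (esym (ge0_integral_shear1 p mf2 (fun=> f0 _)))).
apply: eq_integral => w _; congr (f (_, _)); rewrite /=; apply/esym.
  transitivity ((1 - v * p) * w.1 + (p * (1 + (1 - v * p))) * w.2)%R; last by ring.
  by rewrite vp opprB addrCA subrr addr0 pu.
transitivity ((1 - v * p) * w.2 - v * w.1)%R; last by ring.
by rewrite vp opprB addrCA subrr addr0.
Qed.

(** Each vertical section has at most two points. The cases of use are the origin and the boundary
    circle of the disc. *)
Lemma leb2_circle (c : R) :
  measurable [set w : mR * mR | (w.1 ^+ 2 + w.2 ^+ 2 = c)%R] /\
  leb2 [set w : mR * mR | (w.1 ^+ 2 + w.2 ^+ 2 = c)%R] = 0.
Proof.
split.
  have mc : measurable_fun setT
      (fun w : mR * mR => (w.1 ^+ 2 + w.2 ^+ 2)%R).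
    by apply: measurable_funD; exact: measurable_funX.
  rewrite -[X in measurable X]setTI.
  exact: (mc measurableT [set c] (measurable_set1 c)).
rewrite /product_measure1; apply: integral0_eq => x _.
apply: countable_lebesgue_measure0; apply: finite_set_countable.
apply: (@sub_finite_set _ _ [set Num.sqrt (c - x ^+ 2)%R; (- Num.sqrt (c - x ^+ 2))%R]).
  move=> y; rewrite /xsection/= inE/= => <-.
  have -> : (x ^+ 2 + y ^+ 2 - x ^+ 2 = y ^+ 2)%R by ring.
  rewrite sqrtr_sqr.
  by case: (ger0P y) => _; [left|right; rewrite opprK].
by rewrite finite_setU.
Qed.

End plane.

(** * Measurability of derivatives, and integrability of 1 / sqrt (rho^2 - r^2) on the disc *)

Section analysis.
Context {R : realType}.
Implicit Types (h k : R -> R).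
Local Notation mu := (@lebesgue_measure R).
Local Notation leb2 := (@lebesgue_measure R \x @lebesgue_measure R)%E.

Lemma measurable_fun_sqrt d (T : measurableType d) (D : set T) (f : T -> R) :
  measurable_fun D f -> measurable_fun D (fun x => Num.sqrt (f x)).
Proof.
move=> mf; apply: (measurableT_comp (f := @Num.sqrt R)) mf.
by apply: continuous_measurable_fun; exact: sqrt_continuous.
Qed.

(** On nonnegative reals the inverse is the power of exponent -1, even at 0, where both take the
    value 0. *)
Lemma measurable_fun_inv_ge0 d (T : measurableType d) (D : set T) (f : T -> R) :
  (forall x, 0 <= f x) -> measurable_fun D f -> measurable_fun D (fun x => (f x)^-1).
Proof.
move=> f0 mf; rewrite (_ : (fun _ => _) = ((@powR R) ^~ (-1)) \o f).
  by apply: measurableT_comp => //; exact: measurable_powR.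
by apply/funext => x /=; rewrite powR_inv1.
Qed.

Lemma measurable_fun_inv_sqrt d (T : measurableType d) (D : set T) (f : T -> R) :
  measurable_fun D f -> measurable_fun D (fun x => (Num.sqrt (f x))^-1).
Proof.
move=> mf; apply: measurable_fun_inv_ge0 => [x|]; first exact: sqrtr_ge0.
exact: measurable_fun_sqrt.
Qed.

(* A derivative is a pointwise limit of difference quotients; the increment
   at [x] is a fraction of [b - x] so as to stay inside the interval. *)
Lemma measurable_fun_is_derive h k (a b : R) :
  (forall x, a < x < b -> is_derive x 1 h (k x)) ->
  measurable_fun (`]a, b[%classic : set R) k.
Proof.
move=> hk.
(* The denominator is at least 2, so [x + s n x] stays strictly below [b] already for [n = 0]. *)
pose s n x : R := (b - x) / n.+2%:R.
have s0 n x : a < x < b -> 0 < s n x.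
  by move=> /andP[_ xb]; rewrite divr_gt0// subr_gt0.
have ch x : a < x < b -> {for x, continuous h}.
  move=> /hk hx; apply/differentiable_continuous/derivable1_diffP; exact: ex_derive.
have mh : measurable_fun (`]a, b[%classic : set R) h.
  apply: open_continuous_measurable_fun; first exact: interval_open.
  by move=> x; rewrite inE/= in_itv/=; exact: ch.
have ms n : measurable_fun setT (s n).
  by apply: measurable_funM => //; exact: measurable_funB.
apply: (@measurable_fun_cvg _ _ R (`]a, b[%classic : set R)
  (fun n x => (h (x + s n x) - h x) / s n x) k).
  move=> n; apply: measurable_funM.
    apply: measurable_funB => //.
    apply: (@measurable_comp _ _ _ _ _ _ (`]a, b[%classic : set R) h) => //.
      move=> _ [x /= + <-]; rewrite !in_itv/= => xab; have /andP[ax xb] := xab.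
      rewrite (lt_trans ax) ?ltrDl ?s0//=.
      rewrite addrC -ltrBrDr /s ltr_pdivrMr// ltr_pMr ?subr_gt0//.
      by rewrite ltr1n.
    apply: measurable_funD => //; exact: measurable_funTS.
  (* On the interval [b - x] is positive, so it equals the root of its square and the measurability
     of inverse roots applies. *)
  have mg : measurable_fun (`]a, b[%classic : set R)
      (fun x : R => n.+2%:R * (Num.sqrt ((b - x) ^+ 2))^-1).
    apply: measurable_funM => //; apply: measurable_fun_inv_sqrt.
    by apply: measurable_funX; exact: measurable_funB.
  apply: eq_measurable_fun mg => x; rewrite inE/= in_itv/= => /andP[_ xb].
  by rewrite /s invf_div sqrtr_sqr gtr0_norm ?subr_gt0.
move=> x; rewrite /= in_itv/= => xab.
have [dh dhE] := hk x xab.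
have s_cvg : s n x @[n --> \oo] --> (0 : R).
  rewrite /s -[X in _ --> X](mulr0 (b - x)); apply: cvgM; first exact: cvg_cst.
  have := @cvg_harmonic R; rewrite -cvg_shiftS; exact: cvg_trans.
have : (fun t => t^-1 *: ((h \o shift x) (t *: 1) - h x)) @ 0^' --> k x.
  by rewrite -dhE.
move=> hcvg P /hcvg; rewrite /nbhs/= => hP.
have {}hP : \forall t \near (0:R), t != 0 -> P (t^-1 *: ((h \o shift x) (t *: 1) - h x)).
  exact: hP.
have : \forall n \near \oo, s n x != 0 ->
  P ((s n x)^-1 *: ((h \o shift x) (s n x *: 1) - h x)) by exact: (s_cvg _ hP).
move=> Ps; suff Pq : \forall n \near \oo, P ((h (x + s n x) - h x) / s n x) by exact: Pq.
move: Ps; apply: filterS => n /=; rewrite gt_eqF ?s0// => /(_ isT).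
by rewrite [_ *: 1]mulr1 [(x + _)%R]addrC [_ *: _]mulrC.
Qed.

Lemma measurable_radius :
  measurable_fun [set: measurableTypeR R * measurableTypeR R] (@radius R).
Proof.
by apply: measurable_fun_sqrt; apply: measurable_funD; exact: measurable_funX.
Qed.

Lemma radius_ge0 (w : R * R) : 0 <= radius w.
Proof. exact: sqrtr_ge0. Qed.

Lemma sqr_radius (w : R * R) : radius w ^+ 2 = w.1 ^+ 2 + w.2 ^+ 2.
Proof. by rewrite sqr_sqrtr// addr_ge0 ?sqr_ge0. Qed.

Lemma is_derive_asin_scale (s y : R) : 0 < s -> - s < y < s ->
  is_derive y 1 (fun t => asin (t / s)) (Num.sqrt (s ^+ 2 - y ^+ 2))^-1.
Proof.
move=> s0 /andP[sy ys].
have ys1 : -1 < y / s < 1.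
  by rewrite ltr_pdivrMr// mul1r ys andbT ltr_pdivlMr// mulN1r.
have -> : (Num.sqrt (s ^+ 2 - y ^+ 2))^-1 = (Num.sqrt (1 - (y / s) ^+ 2))^-1 * s^-1.
  rewrite -invfM; congr (_^-1).
  have -> : s ^+ 2 - y ^+ 2 = (1 - (y / s) ^+ 2) * s ^+ 2 by field; rewrite gt_eqF.
  rewrite sqrtrM ?sqrtr_sqr ?gtr0_norm// subr_ge0.
  by move: ys1 => /andP[? ?]; nra.
have dl : is_derive y 1 (fun t : R => t / s) s^-1.
  have -> : (fun t : R => t / s) = s^-1 *: id by apply/funext => t; rewrite /= mulrC.
  by rewrite -[X in is_derive _ _ _ X]mulr1; exact: is_deriveZ.
exact: (@is_derive1_comp _ (@asin R) (fun t => t / s) _ _ _ (is_derive1_asin ys1) dl).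
Qed.

Local Open Scope ereal_scope.

(** The primitive asin (y / s) varies by at most [pi]. Since the integrand blows up at the
    endpoints, the fundamental theorem is applied on compact intervals exhausting the open one, and
    monotone convergence concludes. *)
Lemma integral_inv_sqrt_le_pi (s : R) : (0 < s)%R ->
  \int[mu]_y ((Num.sqrt (s ^+ 2 - y ^+ 2))^-1)%:E <= pi%:E.
Proof.
move=> s0.
have dF (y : R) : (- s < y < s)%R ->
    is_derive y 1%R (fun t : R => asin (t / s)%R) (Num.sqrt (s ^+ 2 - y ^+ 2))^-1%R.
  exact: is_derive_asin_scale.
have cF (y : R) : (- s < y < s)%R -> {for y, continuous (fun t : R => asin (t / s)%R)}.
  by move=> /dF ?; apply/differentiable_continuous/derivable1_diffP; exact: ex_derive.
pose c (n : nat) : R := (s - s / n.+2%:R)%R.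
have c0 n : (0 < c n)%R.
  by rewrite /c subr_gt0 ltr_pdivrMr// ltr_pMr// ltr1n.
have cs n : (c n < s)%R by rewrite /c ltrBlDr ltrDl divr_gt0.
pose F (n : nat) : set R := `[(- c n)%R, c n]%classic.
have ndF : nondecreasing_seq F.
  move=> m n mn; apply/subsetPset => y; rewrite /F /= !in_itv/= -!ler_norml.
  move=> /le_trans; apply; rewrite /c lerD2l lerN2 ler_pM2l// lef_pV2 ?posrE//.
  by rewrite ler_nat !ltnS.
have mg : measurable_fun [set: R] (fun y : R => ((Num.sqrt (s ^+ 2 - y ^+ 2))^-1)%:E).
  apply/measurable_EFinP; apply: measurable_fun_inv_sqrt.
  by apply: measurable_funB => //; exact: measurable_funX.
have -> : \int[mu]_y ((Num.sqrt (s ^+ 2 - y ^+ 2))^-1)%:E =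
    \int[mu]_(y in \bigcup_n F n) ((Num.sqrt (s ^+ 2 - y ^+ 2))^-1)%:E.
  rewrite [RHS]integral_mkcond; apply: eq_integral => x _; rewrite patchE.
  case: ifPn => //; rewrite notin_setE => Fx.
  (* Outside every [F n] the radicand is nonpositive, so the root is 0, and its inverse is 0 by
     convention. *)
  rewrite ler0_sqrtr ?invr0//.
  rewrite subr_le0 -[leRHS]real_normK ?num_real// lerXn2r ?nnegrE ?(ltW s0)//.
  rewrite leNgt; apply/negP => ys; apply: Fx.
  (* This [n] satisfies s / (s - |x|) < n + 1, whence s / (n + 2) <= s - |x|, that is |x| <=
     [c n]. *)
  exists (Num.truncn (s / (s - `|x|)%R)) => //; rewrite /F/= in_itv/= -ler_norml /c.
  rewrite lerBrDr addrC -lerBrDr ler_pdivrMr// mulrC -ler_pdivrMr ?subr_gt0//.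
  by rewrite ltW// (lt_le_trans (Num.Theory.truncnS_gt _))// ler_nat.
have mF n : measurable (F n) by exact: measurable_itv.
have mgF n : measurable_fun (F n)
    (fun y : R => ((Num.sqrt (s ^+ 2 - y ^+ 2))^-1)%:E) by exact: measurable_funTS.
have gF n y : F n y -> 0 <= ((Num.sqrt (s ^+ 2 - y ^+ 2))^-1)%:E.
  by move=> _; rewrite lee_fin invr_ge0.
have cvgF := @ge0_nondecreasing_set_cvg_integral _ (measurableTypeR R) R F _ mu ndF mF mgF gF.
apply: (cvge_le _ cvgF).
apply: nearW => n.
rewrite (@continuous_FTC2 _ _ (fun t : R => asin (t / s)%R)).
+ rewrite -EFinD lee_fin.
  have c1 : (0 <= c n / s)%R by rewrite divr_ge0// ltW.
  have c2 : (c n / s <= 1)%R by rewrite ler_pdivrMr// mul1r ltW.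
  have -> : (pi = pi / 2 - - (pi / 2) :> R)%R by rewrite opprK -splitr.
  apply: lerB.
    by apply: asin_lepi2; rewrite c2 andbT (le_trans _ c1)// lerN10.
  by apply: asin_geNpi2; rewrite mulNr lerN2 c2/= (le_trans _ (@ler01 R))// oppr_le0.
+ by rewrite gtrN.
+ apply: continuous_in_subspaceT => y; rewrite inE/= in_itv/= => /andP[y1 y2].
  have sy : (0 < s ^+ 2 - y ^+ 2)%R by have := cs n; nra.
  apply: cvgV; first by rewrite gt_eqF// sqrtr_gt0.
  apply: continuous_cvg; first exact: sqrt_continuous.
  by apply: cvgB; [exact: cvg_cst|exact: exprn_continuous].
+ have ns : (- s < - c n)%R by rewrite ltrN2.
  have nc : (- c n < c n)%R by rewrite gtrN.
  split.
  * move=> y; rewrite in_itv/= => /andP[y1 y2]; apply: ex_derive; apply: dF.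
    by rewrite (lt_trans ns)//= (lt_trans y2).
  * by apply: cvg_at_right_filter; apply: cF; rewrite ns (lt_trans nc).
  * by apply: cvg_at_left_filter; apply: cF; rewrite cs (lt_trans ns).
+ move=> y; rewrite in_itv/= => /andP[y1 y2]; rewrite derive1E.
  apply: derive_val; apply: dF.
  by rewrite (lt_trans _ y1) ?ltrN2// (lt_trans y2).
Qed.

(* Outside the disc the square root, hence its inverse, is 0. *)
Lemma integral_disc_inv_sqrt_lty (rho : R) : (0 < rho)%R ->
  \int[leb2]_w ((Num.sqrt (rho ^+ 2 - radius w ^+ 2))^-1)%:E < +oo.
Proof.
move=> rho0.
have mf : measurable_fun [set: measurableTypeR R * measurableTypeR R]
    (fun w => ((Num.sqrt (rho ^+ 2 - radius w ^+ 2))^-1)%:E).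
  apply/measurable_EFinP; apply: measurable_fun_inv_sqrt.
  apply: measurable_funB => //; apply: measurable_funX; exact: measurable_radius.
rewrite (fubini_tonelli1 (m1 := mu) (m2 := mu) _ mf); last first.
  by move=> w; rewrite lee_fin invr_ge0.
(* Every vertical slice contributes at most [pi], whatever its length, and the slices with |x| >=
   [rho] contribute 0. *)
apply: (@le_lt_trans _ _ (\int[mu]_(x in `](- rho)%R, rho[) cst pi%:E x)); last first.
  rewrite integral_cst//= lebesgue_measure_itv/= lte_fin gtrN// -EFinD -EFinM.
  exact: ltry.
rewrite [leRHS]integral_mkcond.
apply: ge0_le_integral => //.
- by move=> x _; apply: integral_ge0 => y _; rewrite lee_fin invr_ge0.
- exact: measurable_fun_fubini_tonelli_F.
- by apply/(measurable_restrictT _ _).1.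
move=> x _; rewrite /fubini_F patchE; case: ifPn => [|].
  rewrite inE/= in_itv/= => /andP[x1 x2].
  have s0 : (0 < Num.sqrt (rho ^+ 2 - x ^+ 2))%R by rewrite sqrtr_gt0; nra.
  apply: (le_trans _ (integral_inv_sqrt_le_pi s0)); rewrite le_eqVlt; apply/orP; left.
  apply/eqP; apply: eq_integral => y _; congr (_^-1)%:E; congr Num.sqrt.
  rewrite sqr_radius sqr_sqrtr; last by rewrite ltW// -sqrtr_gt0.
  by rewrite /= opprD addrA.
rewrite notin_setE/= in_itv/= -ltr_norml => /negP; rewrite -leNgt => xrho.
rewrite integral0_eq// => y _; rewrite ler0_sqrtr ?invr0//.
rewrite subr_le0 sqr_radius/= (@le_trans _ _ (x ^+ 2)%R) ?lerDl ?sqr_ge0//.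
by rewrite -[leRHS]real_normK ?num_real// lerXn2r ?nnegrE ?(ltW rho0).
Qed.
End analysis.

(** * Differentials, tangent vectors and p-normals of graphs of revolution *)

Section geometry.
Context {R : realType}.
Implicit Types (h : R -> R) (w v : R * R) (p q : R * R * R).

Lemma is_diff_fst (U V : normedModType R) (x : U * V) : is_diff x fst fst.
Proof.
have c : continuous (fst : U * V -> U) by move=> y; exact: cvg_fst.
apply: DiffDef; first exact: (@linear_differentiable _ _ _ fst).
exact: (@diff_lin _ _ _ fst).
Qed.

Lemma is_diff_snd (U V : normedModType R) (x : U * V) : is_diff x snd snd.
Proof.
have c : continuous (snd : U * V -> V) by move=> y; exact: cvg_snd.
apply: DiffDef; first exact: (@linear_differentiable _ _ _ snd).
exact: (@diff_lin _ _ _ snd).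
Qed.

Lemma is_derive_is_diff (V : normedModType R) (f : R -> V) (x : R) (l : V) :
  is_derive x 1 f l -> is_diff x f (fun t => t *: l).
Proof.
move=> [df dfE]; apply: DiffDef; first exact/derivable1_diffP.
by rewrite diff1E ?derive1E ?dfE//; exact/derivable1_diffP.
Qed.

Lemma is_diff_is_derive (V : normedModType R) (f : R -> V) (x : R) (df : R -> V) :
  is_diff x f df -> is_derive x 1 f (df 1).
Proof.
move=> [fx <-]; apply: DeriveDef; first exact/derivable1_diffP.
by rewrite -derive1E derive1E'.
Qed.

Lemma radius_gt0 w : w != 0 -> 0 < radius w.
Proof.
move=> w0; rewrite sqrtr_gt0 lt0r addr_ge0 ?sqr_ge0// andbT.
rewrite paddr_eq0 ?sqr_ge0// !sqrf_eq0.
by case: w w0 => x y; apply: contra => /= /andP[/eqP -> /eqP ->].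
Qed.

Lemma is_diff_radius w : 0 < radius w ->
  is_diff w (@radius R) (fun v => (w.1 * v.1 + w.2 * v.2) / radius w).
Proof.
move=> r0.
have d1 := is_diff_fst w; have d2 := is_diff_snd w.
have dq := is_diffD (is_diffX 1 d1) (is_diffX 1 d2).
have dr : is_derive (w.1 ^+ 2 + w.2 ^+ 2) 1 (@Num.sqrt R) (2 * radius w)^-1.
  by apply: is_derive1_sqrt; rewrite -sqrtr_gt0.
apply: is_diff_eq; first exact: (is_diff_comp dq (is_derive_is_diff dr)).
apply/funext => v /=.
change ((2 * w.1 * v.1 + 2 * w.2 * v.2) * (2 * radius w)^-1 =
  (w.1 * v.1 + w.2 * v.2) / radius w).
by field; rewrite gt_eqF.
Qed.

Lemma is_diff_revolve h (k : R) w : 0 < radius w -> is_derive (radius w) 1 h k ->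
  is_diff w (revolve h) (fun v => k * ((w.1 * v.1 + w.2 * v.2) / radius w)).
Proof.
move=> r0 hk.
apply: is_diff_eq; first exact: (is_diff_comp (is_diff_radius r0) (is_derive_is_diff hk)).
by apply/funext => v; exact: mulrC.
Qed.

(** Left translation by [g] is affine, so its differential is its linear part, the same at every
    [p]. *)
Lemma pushE (g p v : R * R * R) :
  push g p v = (v.1.1, v.1.2, v.2 + g.1.2 * v.1.1 - g.1.1 * v.1.2).
Proof.
rewrite /push.
pose df (v : R * R * R) := (v.1.1, v.1.2, v.2 + g.1.2 * v.1.1 - g.1.1 * v.1.2).
have d1 := is_diff_fst p; have d2 := is_diff_snd p.
have d11 := is_diff_comp d1 (is_diff_fst p.1).
have d12 := is_diff_comp d1 (is_diff_snd p.1).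
have D1 := is_diffD (is_diff_cst g.1.1 p) d11.
have D2 := is_diffD (is_diff_cst g.1.2 p) d12.
have D3 := is_diffB (is_diffD (is_diffD (is_diff_cst g.2 p) d2) (is_diffZ g.1.2 d11))
  (is_diffZ g.1.1 d12).
have D : is_diff p (hmul g : R * R * R -> R * R * R) df.
  apply: (is_diff_eq (is_diff_pair (is_diff_pair D1 D2) D3)).
  apply/funext => u; change ((0 + u.1.1, 0 + u.1.2,
    0 + u.2 + g.1.2 * u.1.1 - g.1.1 * u.1.2) = df u).
  by rewrite !add0r.
by rewrite diff_val.
Qed.

(** The value depends on neither [g] nor [q]: one formula serves the translates of [u(0)] from the
    origin and those of a p-normal from a point of the Pansu sphere. *)
Lemma push_levi p q (g v n : R * R * R) : contact_plane q n ->
  levi q (push g p v) n = v.1.1 * n.1.1 + v.1.2 * n.1.2.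
Proof. by rewrite /contact_plane/= /levi pushE => ->; rewrite mulr0 addr0. Qed.

Lemma polar w : exists2 t : R, 0 <= t <= 2 * pi &
  w = (radius w * cos t, radius w * sin t).
Proof.
have [->|w0] := eqVneq w 0.
  exists 0; first by rewrite lexx mulr_ge0 ?pi_ge0.
  by rewrite /radius/= expr0n addr0 sqrtr0 !mul0r.
have r0 := radius_gt0 w0.
have r2 : radius w ^+ 2 = w.1 ^+ 2 + w.2 ^+ 2 by rewrite sqr_sqrtr ?addr_ge0 ?sqr_ge0.
pose c := w.1 / radius w.
have c1 : -1 <= c <= 1.
  rewrite -ler_norml normrM normfV (gtr0_norm r0) ler_pdivrMr// mul1r.
  by rewrite -sqrtr_sqr ler_wsqrtr// lerDl sqr_ge0.
have wc : w.1 = radius w * c by rewrite mulrC divfK// gt_eqF.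
have ws : radius w * Num.sqrt (1 - c ^+ 2) = `|w.2|.
  rewrite -[X in X * _](gtr0_norm r0) -sqrtr_sqr -sqrtrM ?sqr_ge0// -sqrtr_sqr.
  by congr Num.sqrt; rewrite mulrBr mulr1 -exprMn -wc r2; ring.
have a0 : 0 <= acos c by exact: acos_ge0.
have api : acos c <= pi by exact: acos_lepi.
have [w2|w2] := leP 0 w.2.
  exists (acos c); first by rewrite a0/= (le_trans api)// ler_peMl ?pi_ge0// ler1n.
  rewrite acosK// sin_acos// ws ger0_norm// -wc; by case: (w).
(* In the lower half-plane the angle given by [acos] is reflected, to stay within 0 and 2 pi. *)
exists (2 * pi - acos c).
  rewrite subr_ge0 (le_trans api) ?ler_peMl ?pi_ge0 ?ler1n//=.
  by rewrite lerBlDr lerDl.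
have -> : 2 * pi - acos c = - acos c + pi *+ 2 by rewrite addrC mulr2n; ring.
rewrite cosD2pi sinD2pi cosN sinN acosK// sin_acos// mulrN ws ltr0_norm// opprK -wc.
by case: (w).
Qed.

Lemma sheet_graph (rho : R) h w : radius w <= rho -> sheet rho h (w, revolve h w).
Proof.
move=> wrho; have [t tpi {1}->] := polar w.
by exists (radius w), t; rewrite sqrtr_ge0.
Qed.

(* At a crossing of the two sheets the tangent space may be larger than the
   tangent plane of one sheet; only this inclusion is needed. *)
Lemma tangent_space_graph (rho : R) h (k : R) (S : set (R * R * R)) w v :
  sheet rho h `<=` S -> 0 < radius w < rho -> is_derive (radius w) 1 h k ->
  tangent_space S (w, revolve h w)
    (v, k * ((w.1 * v.1 + w.2 * v.2) / radius w)).
Proof.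
move=> hS /andP[r0 rrho] hk.
(* The curve is the lift to the graph of a straight line through [w]; it remains in the sheet for
   small [t] because [radius w < rho]. *)
pose l (t : R) : R * R := w + t *: v.
have l0 : l 0 = w by rewrite /l scale0r addr0.
have dl : is_diff (0 : R) l (fun t => t *: v).
  have d1 := is_diff_cst w (0 : R).
  have d2 := is_diff_scalel (0 : R) v.
  have d3 := is_diffD d1 d2.
  apply: (is_diff_eq d3).
  by apply/funext => t; exact: add0r.
have df : is_diff (l 0) (revolve h) (fun v => k * ((w.1 * v.1 + w.2 * v.2) / radius w)).
  by rewrite l0; exact: is_diff_revolve.
exists (fun t => (l t, revolve h (l t))); split.
- by rewrite l0.
- have cr : {for 0, continuous (@radius R \o l)}.
    apply: continuous_comp; first exact/differentiable_continuous/ex_diff.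
    rewrite l0; have := is_diff_radius r0 => ?.
    exact/differentiable_continuous/ex_diff.
  have rl : radius (l 0) < rho by rewrite l0.
  have : \forall t \near (0 : R), radius (l t) < rho by exact: (cr _ (lt_nbhsl rl)).
  by apply: filterS => t /ltW trho; apply: hS; exact: sheet_graph.
have := is_diff_is_derive (is_diff_pair dl (is_diff_comp dl df)).
by rewrite /= [_ *: v]scale1r [_ *: v.1]mul1r [_ *: v.2]mul1r.
Qed.

Lemma pnormal_graph (rho : R) h (k : R) (S : set (R * R * R)) w n (u v : R) :
  let a := k * (w.1 / radius w) - w.2 in
  let b := k * (w.2 / radius w) + w.1 in
  sheet rho h `<=` S -> 0 < radius w < rho -> is_derive (radius w) 1 h k ->
  is_pnormal S (w, revolve h w) n ->
  `|u * n.1.1 + v * n.1.2| * Num.sqrt (a ^+ 2 + b ^+ 2) = `|u * a + v * b|.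
Proof.
move=> a b hS r0 hk [_ nxi n1 nperp].
have nn : n.1.1 ^+ 2 + n.1.2 ^+ 2 = 1.
  by rewrite -n1 /levi nxi mulr0 addr0.
have orth : n.1.2 * a = n.1.1 * b.
  have [/andP[r1 _]] := r0.
  (* The last coordinate is the slope of the graph in the direction [(- b, a)], and it is exactly
     the one that makes the vector horizontal. *)
  pose t : R * R * R := ((- b, a), k * ((w.1 * - b + w.2 * a) / radius w)).
  have tS : (tangent_space S (w, revolve h w) `&` contact_plane (w, revolve h w)) t.
    split; first exact: (tangent_space_graph (- b, a) hS r0 hk).
    rewrite /contact_plane/contact_form/= /a /b.
    by field; rewrite gt_eqF.
  have := nperp _ tS; rewrite /levi nxi mul0r addr0/= mulrN => /eqP.
  by rewrite addrC subr_eq0 => /eqP.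
(* As [(a, b)] is parallel to the unit vector [n], it is [s] times the horizontal part of [n]; hence
   |s| is the p-area density, possibly 0. *)
pose s := n.1.1 * a + n.1.2 * b.
have aE : a = n.1.1 * s.
  rewrite /s mulrDr [n.1.1 * (n.1.2 * b)]mulrCA -orth.
  by rewrite -[LHS]mul1r -nn; ring.
have bE : b = n.1.2 * s.
  rewrite /s mulrDr [n.1.2 * (n.1.1 * a)]mulrCA orth.
  by rewrite -[LHS]mul1r -nn; ring.
rewrite (_ : a ^+ 2 + b ^+ 2 = s ^+ 2); last first.
  by rewrite aE bE !exprMn -mulrDl nn mul1r.
rewrite sqrtr_sqr -normrM; congr (`|_|).
by rewrite [in RHS]aE [in RHS]bE; ring.
Qed.

Lemma parea_density_revolve h (k : R) w : 0 < radius w -> is_derive (radius w) 1 h k ->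
  parea_density (revolve h) w =
  Num.sqrt ((k * (w.1 / radius w) - w.2) ^+ 2 + (k * (w.2 / radius w) + w.1) ^+ 2).
Proof.
move=> r0 hk; have d := is_diff_revolve r0 hk.
rewrite /parea_density !deriveE ?diff_val; [|exact: ex_diff..].
by rewrite !mulr0 !mulr1 addr0 add0r.
Qed.

End geometry.

(** * The projected p-area of one sheet *)

Section sheets.
Context {R : realType}.
Implicit Types (h k : R -> R) (w : R * R).
Local Notation mu := (@lebesgue_measure R).
Local Notation leb2 := (@lebesgue_measure R \x @lebesgue_measure R)%E.
Local Notation mR := (measurableTypeR R).

(** The interval is a neighbourhood of an interior point, so restricting to it does not change the
    limit; the rest is the change of variable t - r. *)
Lemma deriv_within_is_derive (rho : R) h (r l : R) : 0 < r < rho ->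
  deriv_within `[0, rho] h r l -> is_derive r 1 h l.
Proof.
move=> rrho hl.
have c : t^-1 *: ((h \o shift r) (t *: 1) - h r) @[t --> 0^'] --> l.
  move=> P /hl hP.
  have {}hP : \forall t \near r, t != r -> `[0, rho]%classic t -> P ((h t - h r) / (t - r)).
    exact: hP.
  have rI : \forall t \near r, `[0, rho]%classic t.
    have : r \in `]0, rho[ by rewrite in_itv.
    by move=> /near_in_itvoo; apply: filterS => t; exact: subset_itv_oo_cc.
  have {}hP : \forall t \near r, t != r -> P ((h t - h r) / (t - r)).
    by apply: filterS2 hP rI => t + ? tr; apply.
  have {}hP : \forall t \near (0 : R), t + r != r -> P ((h (t + r) - h r) / (t + r - r)).
    have sc : {for 0, continuous (fun t : R => t + r)}.
      by move=> ?; apply: cvgD; [exact: cvg_id|exact: cvg_cst].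
    have := sc; rewrite /prop_for /continuous_at add0r => {}sc.
    exact: (sc _ hP).
  have {}hP : \forall t \near (0 : R), t != 0 -> P (t^-1 *: ((h \o shift r) (t *: 1) - h r)).
    apply: filterS hP => t + t0; rewrite addrK => /(_ _)/=.
    rewrite [t *: 1]mulr1 [_ *: _]mulrC; apply.
    by rewrite -subr_eq0 addrK.
  exact: hP.
apply: DeriveDef; first by apply/cvg_ex; exists l.
exact: cvg_lim c.
Qed.

(** Both regularity conditions enter through this common bound. A bound [M] on a continuous
    derivative is turned into it by sqrt (rho^2 - r^2) <= rho; the other condition gives it with
    [K = rho] since r < rho. *)
Lemma profile_derivative (rho : R) h : 0 < rho ->
  C1_profile rho h \/ bounded_profile rho h ->
  exists k (K : R), 0 <= K /\ forall r, 0 < r < rho ->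
    is_derive r 1 h (k r) /\ `|k r| <= K / Num.sqrt (rho ^+ 2 - r ^+ 2).
Proof.
move=> rho0.
have s0 r : 0 < r < rho -> 0 < Num.sqrt (rho ^+ 2 - r ^+ 2).
  by move=> /andP[r0 r1]; rewrite sqrtr_gt0; nra.
move=> [[k [hk kc]]|[k [hk kb]]]; exists k.
  have ck : compact (k @` `[0, rho]%classic).
    by apply: continuous_compact => //; exact: segment_compact.
  have [M [_ kM]] := compact_bounded ck.
  (* [compact_bounded] gives a bound by every constant strictly above [M]; this one is also
     nonnegative. *)
  pose K := `|M| + 1.
  have {}kM r : 0 <= r <= rho -> `|k r| <= K.
    move=> r01; apply: (kM K); last by exists r => //; rewrite /= in_itv.
    by rewrite /K (le_lt_trans (ler_norm _))// ltrDl.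
  exists (K * rho); split; first by rewrite mulr_ge0 ?addr_ge0 ?(ltW rho0).
  move=> r r01; have /andP[r0 r1] := r01.
  have r01' : 0 <= r <= rho by rewrite (ltW r0) (ltW r1).
  split; first by apply: (deriv_within_is_derive r01); exact: hk.
  rewrite (le_trans (kM _ r01'))// -mulrA ler_peMr ?addr_ge0//.
  rewrite ler_pdivlMr ?s0// mul1r -[leRHS](gtr0_norm rho0) -sqrtr_sqr.
  by rewrite ler_wsqrtr// gerBl sqr_ge0.
exists rho; split; first exact: ltW.
move=> r r01; have /andP[r0 r1] := r01.
have r01' : 0 <= r < rho by rewrite (ltW r0).
split; first by apply: (deriv_within_is_derive r01); exact: hk.
by rewrite (le_trans (kb _ r01'))// ler_wpM2r ?invr_ge0 ?sqrtr_ge0// ltW.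
Qed.

(** The origin, where the radius is not differentiable, and the boundary circle, where at most a
    one-sided derivative is given, are left out. *)
Definition annulus (rho : R) : set (R * R) := [set w | 0 < radius w < rho].

(* The integrand of the projected p-area along e1, for a profile of derivative [k]. *)
Definition axis_density (rho : R) k : R * R -> R :=
  (fun w => `|k (radius w) * (w.1 / radius w) - w.2|) \_ (annulus rho).

Lemma axis_density_ge0 rho k w : 0 <= axis_density rho k w.
Proof. by rewrite /axis_density patchE; case: ifPn. Qed.

Lemma measurable_annulus (rho : R) : measurable (annulus rho : set (mR * mR)).
Proof.
have := @measurable_radius R measurableT `]0, rho[%classic (measurable_itv _).
by rewrite setTI.
Qed.

Lemma measurable_annulus_radial (rho : R) k : measurable_fun `]0, rho[%classic k ->
  measurable_fun (annulus rho : set (mR * mR)) (fun w => k (radius w)).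
Proof.
move=> mk; apply: (@measurable_comp _ _ _ _ _ _ (`]0, rho[%classic : set R) k) => //.
  by move=> _ [w /= wA <-]; rewrite in_itv.
apply: measurable_funTS; exact: measurable_radius.
Qed.

Lemma axis_densityE rho k w : 0 < radius w < rho ->
  axis_density rho k w = `|k (radius w) * (w.1 / radius w) - w.2|.
Proof. by move=> wA; rewrite /axis_density patchE mem_set. Qed.

Lemma axis_density_out rho k w : ~ (0 < radius w < rho) -> axis_density rho k w = 0.
Proof. by move=> wA; rewrite /axis_density patchE memNset. Qed.

Lemma measurable_div_radius d (T : measurableType d) (D : set T)
  (f : T -> R) (g : T -> mR * mR) : measurable_fun D f -> measurable_fun D g ->
  measurable_fun D (fun x => f x / radius (g x)).
Proof.
move=> mf mg; apply: measurable_funM => //; apply: measurable_fun_inv_ge0.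
  by move=> x; exact: radius_ge0.
exact: (measurableT_comp measurable_radius mg).
Qed.

Lemma measurable_axis_density (rho : R) k :
  measurable_fun (`]0, rho[%classic : set R) k ->
  measurable_fun [set: mR * mR] (axis_density rho k).
Proof.
move=> mk.
have mg : measurable_fun (annulus rho : set (mR * mR))
    (fun w : mR * mR => `|k (radius w) * (w.1 / radius w) - w.2|).
  apply: (measurableT_comp (f := @Num.norm R R)); first exact: normr_measurable.
  apply: measurable_funB; last exact: measurable_funTS.
  apply: measurable_funM; first exact: measurable_annulus_radial.
  by apply: measurable_div_radius => //; exact: measurable_funTS.
exact: (measurable_restrictT _ (measurable_annulus rho)).1 mg.
Qed.

(** The [K] term bounds |k x / r| since |x| <= r. The other bounds |y| < rho, because the root is at
    most [rho] and so rho <= rho^2 / sqrt (rho^2 - r^2). *)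
Lemma axis_density_le (rho : R) k (K : R) w : 0 < rho -> 0 <= K ->
  (forall r, 0 < r < rho -> `|k r| <= K / Num.sqrt (rho ^+ 2 - r ^+ 2)) ->
  axis_density rho k w <= (K + rho ^+ 2) * (Num.sqrt (rho ^+ 2 - radius w ^+ 2))^-1.
Proof.
move=> rho0 K0 kK.
have [wA|wA] := pselect (0 < radius w < rho); last first.
  by rewrite axis_density_out// mulr_ge0 ?invr_ge0 ?sqrtr_ge0// addr_ge0 ?sqr_ge0.
have /andP[r0 r1] := wA.
have s0 : 0 < Num.sqrt (rho ^+ 2 - radius w ^+ 2) by rewrite sqrtr_gt0; nra.
have srho : Num.sqrt (rho ^+ 2 - radius w ^+ 2) <= rho.
  by rewrite -[leRHS](gtr0_norm rho0) -sqrtr_sqr ler_wsqrtr// gerBl sqr_ge0.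
have w1 : `|w.1| <= radius w by rewrite -sqrtr_sqr ler_wsqrtr// lerDl sqr_ge0.
have w2 : `|w.2| <= radius w by rewrite -sqrtr_sqr ler_wsqrtr// lerDr sqr_ge0.
rewrite axis_densityE// mulrDl (le_trans (ler_normB _ _))// lerD//.
  rewrite normrM (le_trans _ (kK _ wA))// ler_piMr//.
  by rewrite normrM normfV (gtr0_norm r0) ler_pdivrMr// mul1r.
rewrite (le_trans w2)// (le_trans (ltW r1))// ler_pdivlMr// expr2.
by rewrite ler_wpM2l// ltW.
Qed.

Local Open Scope ereal_scope.

Lemma integral_axis_density_fin_num (rho : R) k (K : R) : (0 < rho)%R -> (0 <= K)%R ->
  measurable_fun (`]0%R, rho[%classic : set R) k ->
  (forall r, (0 < r < rho)%R -> (`|k r| <= K / Num.sqrt (rho ^+ 2 - r ^+ 2))%R) ->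
  \int[leb2]_w (axis_density rho k w)%:E \is a fin_num.
Proof.
move=> rho0 K0 mk kK; rewrite ge0_fin_numE; last first.
  by apply: integral_ge0 => w _; rewrite lee_fin axis_density_ge0.
have mi : measurable_fun [set: mR * mR]
    (fun w => ((Num.sqrt (rho ^+ 2 - radius w ^+ 2))^-1)%:E).
  apply/measurable_EFinP; apply: measurable_fun_inv_sqrt.
  by apply: measurable_funB => //; apply: measurable_funX; exact: measurable_radius.
have c0 : (0 <= K + rho ^+ 2)%R by rewrite addr_ge0 ?sqr_ge0.
apply: (@le_lt_trans _ _ (\int[leb2]_w
    ((K + rho ^+ 2)%:E * ((Num.sqrt (rho ^+ 2 - radius w ^+ 2))^-1)%:E))).
  apply: ge0_le_integral => //.
  - by move=> w _; rewrite lee_fin axis_density_ge0.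
  - by apply/measurable_EFinP; exact: measurable_axis_density.
  - exact: measurable_funeM.
  - by move=> w _; rewrite -EFinM lee_fin axis_density_le.
rewrite ge0_integralZl//.
by apply: lte_mul_pinfty; rewrite ?lee_fin//; exact: integral_disc_inv_sqrt_lty.
Qed.

(** For a unit vector [(c, s)], this is the rotation taking it to the first axis. *)
Definition rot (c s : R) (w : mR * mR) : mR * mR :=
  (c * w.1 + s * w.2, c * w.2 - s * w.1)%R.

Lemma radius_rot (c s : R) w : (c ^+ 2 + s ^+ 2 = 1)%R -> radius (rot c s w) = radius w.
Proof.
move=> cs; congr Num.sqrt; rewrite /rot/=.
by transitivity ((c ^+ 2 + s ^+ 2) * (w.1 ^+ 2 + w.2 ^+ 2))%R; [ring|rewrite cs mul1r].
Qed.

Lemma integral_axis_density_rot (rho : R) k (c s : R) :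
  measurable_fun (`]0%R, rho[%classic : set R) k -> (c ^+ 2 + s ^+ 2 = 1)%R -> (c != -1)%R ->
  \int[leb2]_w (axis_density rho k (rot c s w))%:E = \int[leb2]_w (axis_density rho k w)%:E.
Proof.
move=> mk cs c1.
apply: (ge0_integral_rotation (f := fun w => (axis_density rho k w)%:E)) => //.
  by apply/measurable_EFinP; exact: measurable_axis_density.
by move=> w; rewrite lee_fin axis_density_ge0.
Qed.

Lemma axis_density_rot (rho : R) k (c s : R) w : (c ^+ 2 + s ^+ 2 = 1)%R ->
  (0 < radius w < rho)%R ->
  axis_density rho k (rot c s w) =
  `|c * (k (radius w) * (w.1 / radius w) - w.2) +
    s * (k (radius w) * (w.2 / radius w) + w.1)|%R.
Proof.
move=> cs wA; rewrite axis_densityE radius_rot//=.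
by congr (`|_|)%R; ring.
Qed.

(* [parea_density] on the annulus, for a profile of derivative [k]. *)
Definition slope_density k w : R :=
  Num.sqrt ((k (radius w) * (w.1 / radius w) - w.2) ^+ 2 +
            (k (radius w) * (w.2 / radius w) + w.1) ^+ 2).

Lemma measurable_slope_density (rho : R) k :
  measurable_fun (`]0%R, rho[%classic : set R) k ->
  measurable_fun (annulus rho : set (mR * mR)) (slope_density k).
Proof.
move=> mk.
have mkr := measurable_annulus_radial mk.
have m1 : measurable_fun (annulus rho : set (mR * mR))
    (fun w : mR * mR => (w.1 / radius w)%R).
  by apply: measurable_div_radius => //; exact: measurable_funTS.
have m2 : measurable_fun (annulus rho : set (mR * mR))
    (fun w : mR * mR => (w.2 / radius w)%R).
  by apply: measurable_div_radius => //; exact: measurable_funTS.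
apply: measurable_fun_sqrt; apply: measurable_funD; apply: measurable_funX.
  by apply: measurable_funB; [exact: measurable_funM|exact: measurable_funTS].
by apply: measurable_funD; [exact: measurable_funM|exact: measurable_funTS].
Qed.

(** A nonnegative measurable function of zero integral vanishes almost everywhere. Thus a p-area
    null set is Lebesgue null in the annulus, apart from points where the density itself is 0. *)
Lemma parea_null_slope (rho : R) h k (S : set (R * R * R)) :
  (forall r, (0 < r < rho)%R -> is_derive r 1%R h (k r)) ->
  measurable_fun (`]0%R, rho[%classic : set R) k ->
  parea_null rho h S ->
  exists Z : set (mR * mR), [/\ measurable Z, leb2 Z = 0 &
    forall w, ~ Z w -> (0 < radius w < rho)%R -> S (w, revolve h w) ->
      slope_density k w = 0%R].
Proof.
move=> hk mk [B [mB SB B0]].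
(* On the annulus [parea_density] agrees with the measurable [slope_density]; passing to this subset
   keeps the integral zero. *)
pose D : set (mR * mR) := B `&` annulus rho.
have mD : measurable D by apply: measurableI => //; exact: measurable_annulus.
have mf : measurable_fun D (fun w => (slope_density k w)%:E).
  apply/measurable_EFinP; apply: measurable_funS (measurable_slope_density mk) => //.
    exact: measurable_annulus.
  exact: subIsetr.
have D0 : \int[leb2]_(w in D) `|(slope_density k w)%:E| = 0.
  apply/eqP; rewrite eq_le integral_ge0 ?andbT// -B0.
  rewrite integral_mkcond [leRHS]integral_mkcond.
  apply: (ge0_le_integral_off_null measurable0 (measure0 leb2)).
  - by apply: erestrict_ge0.
  - by apply: erestrict_ge0 => w _; rewrite lee_fin sqrtr_ge0.
  move=> w _; rewrite !patchE; case: ifPn => [|_]; last first.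
    by case: ifPn => // _; rewrite lee_fin sqrtr_ge0.
  rewrite inE => -[Bw wA]; rewrite mem_set//.
  rewrite gee0_abs; last by rewrite lee_fin sqrtr_ge0.
  by rewrite (parea_density_revolve _ (hk _ wA)); have /andP[] := wA.
have [Z [mZ Z0 DZ]] := (ae_eq_integral_abs leb2 mD mf).1 D0.
exists Z; split => // w Zw wA Sw; apply: contrapT => sw.
apply: Zw; apply: DZ => /= H; apply: sw.
have Dw : D w.
  split => //; apply: SB; split => //; rewrite /disc/=.
  by have /andP[_ /ltW] := wA.
by have [] := H Dw.
Qed.

(** Off a null set the integrand is |sigma| times [axis_density] at the rotated point: by
    [pnormal_graph] at nonsingular points, and because both sides vanish at the remaining ones. *)
Lemma sheet_integral_pnormal (S : set (R * R * R)) (rho : R) h k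
    (N V : R * R * R -> R * R * R) (c s sigma : R) : (0 < rho)%R ->
  (forall r, (0 < r < rho)%R -> is_derive r 1%R h (k r)) ->
  sheet rho h `<=` S -> parea_null rho h [set q | ~ nonsingular S q] ->
  pnormal_field S N -> (c ^+ 2 + s ^+ 2 = 1)%R ->
  (forall q n, contact_plane q n ->
     levi q (V q) n = sigma * (c * n.1.1 + s * n.1.2))%R ->
  sheet_integral rho h (fun q => `|levi q (V q) (N q)|%R) =
  `|sigma|%:E * \int[leb2]_w (axis_density rho k w)%:E.
Proof.
move=> rho0 hk hS null Npn cs VE.
(* The half-turn is excluded from the product of shears. Changing the signs of [c], [s] and [sigma]
   together keeps the field and |sigma|, and turns [c = -1] into 1. *)
wlog c1 : c s sigma cs VE / (c != -1)%R.
  move=> wl; have [cN1|] := eqVneq c (-1)%R; last exact: wl VE.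
  rewrite -(normrN sigma); apply: (wl (- c)%R (- s)%R) => //.
  - by rewrite !sqrrN.
  - by move=> q n /VE ->; ring.
  - by rewrite cN1 opprK gt_eqF// (lt_trans (ltrN10 R)).
have mk : measurable_fun (`]0%R, rho[%classic : set R) k.
  exact: measurable_fun_is_derive hk.
have [Z [mZ Z0 ZE]] := parea_null_slope hk mk null.
have [mC1 C1] := leb2_circle (0 : R).
have [mC2 C2] := leb2_circle (rho ^+ 2)%R.
(* The exceptional set also contains the origin and the boundary circle, so every other point of the
   disc is in the annulus. *)
pose Y : set (mR * mR) := Z `|` ([set w : mR * mR | (w.1 ^+ 2 + w.2 ^+ 2 = 0)%R] `|`
   [set w : mR * mR | (w.1 ^+ 2 + w.2 ^+ 2 = rho ^+ 2)%R]).
have mY : measurable Y by do 2 apply: measurableU => //.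
have Y0 : leb2 Y = 0.
  exact: (null_set_setU mZ (measurableU _ _ mC1 mC2) Z0 (null_set_setU mC1 mC2 C1 C2)).
have mrot : measurable_fun [set: mR * mR] (rot c s).
  apply: measurable_fun_pair.
    by apply: measurable_funD; exact: measurable_funM.
  by apply: measurable_funB; exact: measurable_funM.
have mad : measurable_fun [set: mR * mR] (fun w => (axis_density rho k (rot c s w))%:E).
  apply/measurable_EFinP; apply: (measurableT_comp _ mrot).
  exact: measurable_axis_density.
rewrite -(integral_axis_density_rot mk cs c1) -ge0_integralZl//; last first.
  by move=> w _; rewrite lee_fin axis_density_ge0.
apply: (ge0_eq_integral_off_null mY Y0).
- by move=> w _; rewrite lee_fin mulr_ge0// sqrtr_ge0.
- by move=> w _; rewrite -EFinM lee_fin mulr_ge0// axis_density_ge0.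
move=> w Yw; rewrite !patchE in_setT -EFinM.
have wr0 : radius w != 0%R.
  apply/eqP => r0; apply: Yw; right; left => /=.
  by rewrite -sqr_radius r0 expr0n.
have wrrho : radius w != rho.
  by apply/eqP => r0; apply: Yw; right; right => /=; rewrite -sqr_radius r0.
have r0 : (0 < radius w)%R by rewrite lt0r wr0 radius_ge0.
have [rrho|rrho] := ltP (radius w) rho; last first.
  rewrite memNset; last first.
    by rewrite /disc/= => /(conj rrho)/andP/le_anti/esym/eqP; exact/negP.
  rewrite axis_density_out ?mulr0// radius_rot// => /andP[_].
  by rewrite ltNge rrho.
have wA : (0 < radius w < rho)%R by rewrite r0.
rewrite mem_set; last by rewrite /disc/= ltW.
rewrite axis_density_rot//; congr EFin.
rewrite (parea_density_revolve r0 (hk _ wA)).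
have qS : S (w, revolve h w) by apply: hS; apply: sheet_graph; exact: ltW.
have [ns|sing] := pselect (nonsingular S (w, revolve h w)).
  have pn := Npn _ qS ns; have [_ nxi _ _] := pn.
  rewrite VE// normrM -mulrA; congr (_ * _)%R.
  exact: (pnormal_graph c s hS wA (hk _ wA) pn).
(* At a singular point outside [Z] the density is 0, so the arbitrary value of [N] there is
   harmless; moreover a = b = 0, so the rotated [axis_density] vanishes too. *)
have sl0 : slope_density k w = 0%R.
  by apply: ZE => // Zw; apply: Yw; left.
move: (sl0); rewrite /slope_density => ->; rewrite mulr0.
move/eqP: sl0; rewrite sqrtr_eq0 => sl.
have [/eqP a0 /eqP b0] : (k (radius w) * (w.1 / radius w) - w.2 == 0 /\
    k (radius w) * (w.2 / radius w) + w.1 == 0)%R.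
  apply/andP; rewrite -[X in X && _]sqrf_eq0 -[X in _ && X]sqrf_eq0.
  rewrite -paddr_eq0 ?sqr_ge0// eq_le sl addr_ge0 ?sqr_ge0//.
by rewrite a0 b0 !mulr0 addr0 normr0 mulr0.
Qed.

End sheets.

(** * Sum over the two sheets, evaluated on both families of vectors *)

Theorem proposition1 (R : realType) (Sigma : set (R * R * R)) (rho : R)
    (hp hm : R -> R)
    (rho_gt0 : 0 < rho)
    (Sigma_compact : compact Sigma)
    (Sigma_sym : rotationally_symmetric Sigma)
    (SigmaE : Sigma = sheet rho hp `|` sheet rho hm)
    (hp_ge0 : forall r : R, 0 <= r <= rho -> 0 <= hp r)
    (hm_le0 : forall r : R, 0 <= r <= rho -> hm r <= 0)
    (pnormal_ae :
       parea_null rho hp [set q | ~ nonsingular Sigma q] /\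
       parea_null rho hm [set q | ~ nonsingular Sigma q])
    (hp_reg : C1_profile rho hp \/ bounded_profile rho hp)
    (hm_reg : C1_profile rho hm \/ bounded_profile rho hm) :
  exists C : R,
    forall N : R * R * R -> R * R * R, pnormal_field Sigma N ->
      (forall alpha beta : R, 0 <= alpha <= pi -> 0 <= beta <= 2 * pi ->
         projected_parea rho hp hm N
           (fun q => push q 0
              (sin alpha * cos beta, sin alpha * sin beta, cos alpha))
         = (`|sin alpha| * C)%:E) /\
      (forall (lambda : R) (p n : R * R * R), 0 < lambda ->
         pansu_sphere lambda p -> is_pnormal (pansu_sphere lambda) p n ->
         projected_parea rho hp hm N
           (fun q => push (hmul q (hinv p)) p n)
         = C%:E).
Proof.
case: pnormal_ae => null_p null_m.
have [kp [Kp [Kp0 hkp]]] := profile_derivative rho_gt0 hp_reg.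
have [km [Km [Km0 hkm]]] := profile_derivative rho_gt0 hm_reg.
have dp r (rA : 0 < r < rho) : is_derive r 1 hp (kp r) := (hkp r rA).1.
have dm r (rA : 0 < r < rho) : is_derive r 1 hm (km r) := (hkm r rA).1.
have fp := integral_axis_density_fin_num rho_gt0 Kp0
  (measurable_fun_is_derive dp) (fun r rA => (hkp r rA).2).
have fm := integral_axis_density_fin_num rho_gt0 Km0
  (measurable_fun_is_derive dm) (fun r rA => (hkm r rA).2).
have Sp : sheet rho hp `<=` Sigma by rewrite SigmaE; exact: subsetUl.
have Sm : sheet rho hm `<=` Sigma by rewrite SigmaE; exact: subsetUr.
pose area k : \bar R := (\int[lebesgue_measure \x lebesgue_measure]_w
  (axis_density rho k w)%:E)%E.
(* The constant is the projected p-area along e1, fixed before the p-normal field and the vector; it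
   is real because both integrals are finite. *)
exists (fine (area kp) + fine (area km)) => N Npn.
have projE (V : R * R * R -> R * R * R) (c s sigma : R) : c ^+ 2 + s ^+ 2 = 1 ->
    (forall q n, contact_plane q n ->
      levi q (V q) n = sigma * (c * n.1.1 + s * n.1.2)) ->
    projected_parea rho hp hm N V = (`|sigma| * (fine (area kp) + fine (area km)))%:E.
  move=> cs VE; rewrite /projected_parea.
  rewrite (sheet_integral_pnormal rho_gt0 dp Sp null_p Npn cs VE).
  rewrite (sheet_integral_pnormal rho_gt0 dm Sm null_m Npn cs VE).
  by rewrite -[X in (_ * X + _)%E]fineK// -[X in (_ + _ * X)%E]fineK// mulrDr.
split=> [alpha beta _ _|lambda p n _ _ [_ nxi n1 _]].
  (* The horizontal part of [u(0)] is sin alpha times the unit vector of angle [beta], so [sigma] is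
     [sin alpha]. *)
  apply: (projE _ (cos beta) (sin beta)); first exact: cos2Dsin2.
  by move=> q n qn; rewrite push_levi//=; ring.
(* A p-normal is horizontal of norm 1, so its first two coordinates form a unit vector and
   [sigma = 1]. *)
rewrite (projE _ n.1.1 n.1.2 1) ?normr1 ?mul1r//.
  by rewrite -n1 /levi nxi mulr0 addr0.
by move=> q n' qn; rewrite push_levi//; ring.
Qed.
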